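(* The isomorphism problem for 4-multipedes with shoes is in $\tilde{C}$PTime (choiceless polynomial time, without counting). That is, there is a polynomial time bounded BGS program which, given a pair of 4-multipedes with shoes (as a single 6-sorted structure), decides whether they are isomorphic.
   Context: A 2-multipede is a finite 2-sorted structure with sorts ''segments'' and ''feet'', a function $S$ from feet to segments such that every segment is the image of exactly two feet, a family of 3-element sets of segments called hyperedges (coded as a totally irreflexive symmetric ternary relation), and a family of 3-element sets of feet called positive triples (similarly coded), such that: if $P$ is a positive triple then $S(P)$ is a hyperedge (so $S$ is injective on $P$); for each hyperedge $H$, exactly four of the eight triples of feet mapped by $S$ onto $H$ are positive; and if $P,P'$ are positive with $S(P)=S(P')$ then $|P\triangle P'|$ is even. A 3-multipede is a 2-multipede with a linear ordering $\le$ of the segments. A 4-multipede is a 3-multipede with a third sort ''sets'' and a binary relation $\varepsilon$ between segments and sets such that every set of segments equals $\{s:s\,\varepsilon\,x\}$ for a unique element $x$ of the sort of sets. A multipede with a shoe is a multipede with a distinguished foot (the shoe) such that $S$ of the shoe is the $\le$-first segment. Isomorphisms must preserve all this structure, including the shoe. $\tilde{C}$PTime is the class of Boolean queries decidable by polynomial time bounded BGS programs: abstract state machine programs operating on the hereditarily finite sets over the input's elements (as atoms), with the input relations, logical operations, set functions $\in,\emptyset,$ Atoms, $\bigcup$, TheUnique, Pair, comprehension terms $\{t(v):v\in r:\varphi(v)\}$, dynamic functions updated by rules built from updates, conditionals and parallel ''do forall'' rules, run for at most polynomially many steps with at most polynomially many active elements (in the input size). *)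

(* Defs.v *)
From HB Require Import structures.
From mathcomp Require Import all_boot all_algebra.

Set Implicit Arguments.
Unset Strict Implicit.
Unset Printing Implicit Defensive.

(** * Hereditarily finite sets over a type of atoms

    An object is a tree: a leaf is an atom, a node is a set listing its
    elements. Canonical trees list them without repetition and in the order of
    their codes [pickle], so that Leibniz equality is extensional equality
    (see [hf_ext]). The label of a node carries no information and is fixed
    to 0. *)

Section HF.
Variable A : countType.

Fixpoint canonical_tree (t : GenTree.tree A) : bool :=
  match t with
  | GenTree.Leaf _ => true
  | GenTree.Node n ts =>
      [&& n == 0, sorted ltn (map pickle ts) & all canonical_tree ts]
  end.

Record hf := HF { tree_of :> GenTree.tree A; _ : canonical_tree tree_of }.

HB.instance Definition _ := [isSub for tree_of].
HB.instance Definition _ := [Countable of hf by <:].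

Definition atom (a : A) : hf := @HF (GenTree.Leaf a) isT.

Definition canonical_seq (s : seq hf) : seq (GenTree.tree A) :=
  sort (fun t u => pickle t <= pickle u) (undup (map tree_of s)).

Lemma canonical_seqP (s : seq hf) :
  canonical_tree (GenTree.Node 0 (canonical_seq s)).
Proof.
rewrite /= ltn_sorted_uniq_leq map_inj_uniq; last exact: (pcan_inj pickleK).
rewrite sort_uniq undup_uniq /= sorted_map sort_sorted /=; last first.
  by move=> t u; exact: leq_total.
apply/allP => t; rewrite mem_sort mem_undup => /mapP[x _ ->].
exact: (valP x).
Qed.

(** Atoms have no elements. *)
Definition elems (x : hf) : seq hf :=
  match tree_of x with
  | GenTree.Leaf _ => [::]
  | GenTree.Node _ ts => pmap insub ts
  end.

Definition get_atom (x : hf) : option A :=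
  if tree_of x is GenTree.Leaf a then Some a else None.

End HF.

Arguments atom {A} a.
Arguments elems {A} x.
Arguments get_atom {A} x.

(** The set whose elements are those of the list [s]; locked, so that conversion
    does not compute codes of trees. *)
HB.lock Definition hfset (A : countType) (s : seq (hf A)) : hf A :=
  HF (canonical_seqP s).

Section HFTheory.
Variable A : countType.
Local Notation hf := (hf A).

Lemma get_atomK : ocancel (@get_atom A) atom.
Proof. by case=> [[a|n ts]] // c; apply: val_inj. Qed.

Lemma atomK : pcancel (@atom A) get_atom.
Proof. by []. Qed.

Lemma mem_hfset (s : seq hf) : elems (hfset s) =i s.
Proof.
move=> x; rewrite hfset.unlock /elems /= mem_pmap_sub mem_sort mem_undup mem_map //.
exact: val_inj.
Qed.

Lemma get_atom_hfset (s : seq hf) : get_atom (hfset s) = None.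
Proof. by rewrite hfset.unlock. Qed.

Lemma hf_ext (x y : hf) :
  get_atom x = None -> get_atom y = None -> elems x =i elems y -> x = y.
Proof.
case: x => [[a|n ts]] // c _; case: y => [[b|m us]] // d _ exy.
apply: val_inj => /=.
case/and3P: (c) => /eqP n0 sts cts; case/and3P: (d) => /eqP m0 sus cus.
suff -> : ts = us by rewrite n0 m0.
apply: (inj_map (pcan_inj pickleK)).
apply: (irr_sorted_eq ltn_trans ltnn) => // k.
have eq_mem : ts =i us.
  move=> t; apply/idP/idP => tin.
  - have ct := allP cts t tin; have := exy (HF ct).
    by rewrite /elems /= !mem_pmap_sub /= tin => <-.
  - have ct := allP cus t tin; have := exy (HF ct).
    by rewrite /elems /= !mem_pmap_sub /= tin => ->.
exact: eq_mem_map.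
Qed.

Lemma elemsK (x : hf) : get_atom x = None -> hfset (elems x) = x.
Proof.
by move=> nx; apply: hf_ext (mem_hfset _) => //; exact: get_atom_hfset.
Qed.

Definition hf0 : hf := hfset [::].

(** The truth values are the sets 0 and 1 = {0}. *)
Definition hf_bool (b : bool) : hf := if b then hfset [:: hf0] else hf0.

Definition hf_union (x : hf) : hf := hfset (flatten (map elems (elems x))).

Definition the_unique (x : hf) : hf := if elems x is [:: y] then y else hf0.

(** [in_tc y x]: [x] belongs to the least transitive set containing [y] as an
    element (so [y] itself is included). *)
Inductive in_tc (y : hf) : hf -> Prop :=
| tc_self : in_tc y y
| tc_elem x z : in_tc y z -> x \in elems z -> in_tc y x.

End HFTheory.

Arguments hf0 {A}.
Arguments hf_bool {A} b.

(** * Input structures and BGS programs *)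

(** Finite relational vocabularies and finite structures. Only the values of
    [interp R] at lists of length [arity R] matter. *)
Record vocabulary := Vocabulary {
  relname : finType;
  arity : relname -> nat }.

Record structure (V : vocabulary) := Structure {
  dom : finType;
  interp : relname V -> pred (seq dom) }.

(** The dynamic function names of a program; those marked by [relational] take
    only truth values. [Halt] and [Output] are nullary and relational. *)
Record dyn_vocabulary := DynVocabulary {
  dynname : finType;
  dyn_arity : dynname -> nat;
  relational : pred dynname;
  Halt : dynname;
  Output : dynname;
  Halt_nullary : dyn_arity Halt = 0;
  Output_nullary : dyn_arity Output = 0;
  Halt_relational : relational Halt;
  Output_relational : relational Output }.

Section Syntax.
Variables (V : vocabulary) (D : dyn_vocabulary).

(** [TCompr v t r g] is the comprehension term { t(v) : v in r : g(v) }. *)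
Inductive term :=
| TVar of nat
| TTrue
| TFalse
| TNot of term
| TAnd of term & term
| TOr of term & term
| TEq of term & term
| TIn of term & term
| TEmpty
| TAtoms
| TUnion of term
| TTheUnique of term
| TPair of term & term
| TInput of relname V & seq term
| TDyn of dynname D & seq term
| TCompr of nat & term & term & term.

Definition boolean (t : term) : bool :=
  match t with
  | TTrue | TFalse | TNot _ | TAnd _ _ | TOr _ _
  | TEq _ _ | TIn _ _ | TInput _ _ => true
  | TDyn f _ => relational f
  | _ => false
  end.

(** Arities and truth values are respected, and all free variables are among
    [vs]. *)
Fixpoint wf_term (vs : seq nat) (t : term) : bool :=
  match t with
  | TVar v => v \in vs
  | TTrue | TFalse | TEmpty | TAtoms => true
  | TNot t => wf_term vs t && boolean t
  | TAnd t u | TOr t u =>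
      [&& wf_term vs t, boolean t, wf_term vs u & boolean u]
  | TEq t u | TIn t u | TPair t u => wf_term vs t && wf_term vs u
  | TUnion t | TTheUnique t => wf_term vs t
  | TInput R ts => (size ts == arity R) && all (wf_term vs) ts
  | TDyn f ts => (size ts == dyn_arity f) && all (wf_term vs) ts
  | TCompr v t r g =>
      [&& wf_term (v :: vs) t, wf_term vs r, wf_term (v :: vs) g & boolean g]
  end.

(** [Forall v r R] is the rule "do forall v in r, R". *)
Inductive rule :=
| Skip
| Update of dynname D & seq term & term
| If of term & rule & rule
| Forall of nat & term & rule.

Fixpoint wf_rule (vs : seq nat) (R : rule) : bool :=
  match R with
  | Skip => true
  | Update f ts t =>
      [&& size ts == dyn_arity f, all (wf_term vs) ts, wf_term vs t
        & relational f ==> boolean t]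
  | If g R1 R2 =>
      [&& wf_term vs g, boolean g, wf_rule vs R1 & wf_rule vs R2]
  | Forall v r R => wf_term vs r && wf_rule (v :: vs) R
  end.

End Syntax.

(** A program is a rule without free variables. *)
Record program (V : vocabulary) := Program {
  dyn_voc : dyn_vocabulary;
  body : rule V dyn_voc;
  body_wf : wf_rule [::] body }.

Section Semantics.
Variables (V : vocabulary) (D : dyn_vocabulary) (I : structure V).

Local Notation obj := (hf (dom I)).

(** The dynamic functions; the atoms, the input relations and the
    set-theoretic functions do not change. *)
Definition state := dynname D -> seq obj -> obj.

Definition valuation := nat -> obj.

Definition assign (e : valuation) (v : nat) (x : obj) : valuation :=
  fun w => if w == v then x else e w.

(** An input relation is false outside the atoms. *)
Definition input_holds (R : relname V) (xs : seq obj) : bool :=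
  all (fun x => isSome (get_atom x)) xs &&
  interp R (pmap get_atom xs).

Definition istrue (x : obj) : bool := x == hf_bool true.

Fixpoint eval (A : state) (t : term V D) (e : valuation) : obj :=
  match t with
  | TVar v => e v
  | TTrue => hf_bool true
  | TFalse => hf_bool false
  | TNot t => hf_bool (~~ istrue (eval A t e))
  | TAnd t u => hf_bool (istrue (eval A t e) && istrue (eval A u e))
  | TOr t u => hf_bool (istrue (eval A t e) || istrue (eval A u e))
  | TEq t u => hf_bool (eval A t e == eval A u e)
  | TIn t u => hf_bool (eval A t e \in elems (eval A u e))
  | TEmpty => hf0
  | TAtoms => hfset [seq atom a | a <- enum (dom I)]
  | TUnion t => hf_union (eval A t e)
  | TTheUnique t => the_unique (eval A t e)
  | TPair t u => hfset [:: eval A t e; eval A u e]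
  | TInput R ts => hf_bool (input_holds R [seq eval A t e | t <- ts])
  | TDyn f ts => A f [seq eval A t e | t <- ts]
  | TCompr v t r g =>
      hfset [seq eval A t (assign e v x)
            | x <- [seq x <- elems (eval A r e)
                   | istrue (eval A g (assign e v x))]]
  end.

(** An update [((f, xs), y)] assigns [y] to the location [(f, xs)]. *)
Definition location : Type := dynname D * seq obj.
Definition update : Type := location * obj.

Fixpoint updates (A : state) (R : rule V D) (e : valuation) : seq update :=
  match R with
  | Skip => [::]
  | Update f ts t => [:: (f, [seq eval A t e | t <- ts], eval A t e)]
  | If g R1 R2 =>
      if istrue (eval A g e) then updates A R1 e else updates A R2 e
  | Forall v r R =>
      flatten [seq updates A R (assign e v x) | x <- elems (eval A r e)]
  end.

Definition consistent (us : seq update) : bool :=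
  all (fun u => all (fun u' => (u.1 == u'.1) ==> (u.2 == u'.2)) us) us.

(** An inconsistent update set leaves the state unchanged. *)
Definition fire (us : seq update) (A : state) : state :=
  if consistent us then
    fun f xs =>
      if [seq u.2 | u <- us & u.1 == (f, xs)] is y :: _ then y else A f xs
  else A.

Definition initial : state := fun _ _ => hf0.

(** The body of a program is closed, so the initial valuation is irrelevant. *)
Definition step (R : rule V D) (A : state) : state :=
  fire (updates A R (fun _ => hf0)) A.

Definition run (R : rule V D) (k : nat) : state := iter k (step R) initial.

Definition critical (A : state) (x : obj) : Prop :=
  [\/ (exists a, x = atom a), (exists b, x = hf_bool b),
       (exists f xs, x = A f xs)
     | exists f xs, A f xs <> hf0 /\ x \in xs].

Definition active (A : state) (x : obj) : Prop :=
  exists2 y, critical A y & in_tc y x.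

Definition halted (A : state) : bool := istrue (A (Halt D) [::]).

Definition output (A : state) : bool := istrue (A (Output D) [::]).

End Semantics.

(** A polynomial time bounded program: the first polynomial bounds the number
    of steps of a run, the second the number of objects active in the run. *)
Record ptime_program (V : vocabulary) := PTimeProgram {
  prog :> program V;
  step_bound : {poly nat};
  active_bound : {poly nat} }.

(** On input [I], the run reaches its first halting state, with output [b],
    within the bounds. *)
Definition answers (V : vocabulary) (P : ptime_program V) (I : structure V)
    (b : bool) : Prop :=
  let A := @run V (dyn_voc P) I (body P) in
  let n := #|dom I| in
  exists k,
    [/\ k <= (step_bound P).[n]%R,
        halted (A k) /\ (forall j, j < k -> ~~ halted (A j)),
        (exists l : seq (hf (dom I)),
           size l <= (active_bound P).[n]%R /\
           forall j x, j <= k -> active (A j) x -> x \in l)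
      & output (A k) = b].

Definition accepts V (P : ptime_program V) I := answers P I true.
Definition rejects V (P : ptime_program V) I := answers P I false.

(** The query [Q], on the class of inputs [T] presented to programs through
    [code], is in choiceless polynomial time. *)
Definition in_CPTime (V : vocabulary) (T : Type) (code : T -> structure V)
    (Q : T -> Prop) : Prop :=
  exists P : ptime_program V, forall M : T,
    (Q M -> accepts P (code M)) /\ (~ Q M -> rejects P (code M)).

(** * Multipedes *)

Record multipede2 := Multipede2 {
  seg : finType;
  foot : finType;
  seg_of : foot -> seg;
  hyperedges : {set {set seg}};
  positive : {set {set foot}};
  two_feet : forall s, #|[set f | seg_of f == s]| = 2;
  card_hyperedge : forall H, H \in hyperedges -> #|H| = 3;
  card_positive : forall P, P \in positive -> #|P| = 3;
  positive_hyperedge : forall P, P \in positive -> seg_of @: P \in hyperedges;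
  four_positive : forall H, H \in hyperedges ->
    #|[set P in positive | seg_of @: P == H]| = 4;
  positive_even : forall P P', P \in positive -> P' \in positive ->
    seg_of @: P = seg_of @: P' -> ~~ odd #|(P :\: P') :|: (P' :\: P)| }.

Record multipede3 := Multipede3 {
  multipede3_base :> multipede2;
  sle : rel (seg multipede3_base);
  sle_refl : reflexive sle;
  sle_anti : antisymmetric sle;
  sle_trans : transitive sle;
  sle_total : total sle }.

Record multipede4 := Multipede4 {
  multipede4_base :> multipede3;
  sets : finType;
  eps : seg multipede4_base -> sets -> bool;
  eps_unique : forall X : {set seg multipede4_base},
    exists! x, X = [set s | eps s x] }.

Record shod_multipede4 := ShodMultipede4 {
  shod_base :> multipede4;
  shoe : foot shod_base;
  shoe_first : forall s, sle (seg_of shoe) s }.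

Record isomorphism (M N : shod_multipede4) (fseg : seg M -> seg N)
    (ffoot : foot M -> foot N) (fsets : sets M -> sets N) : Prop := {
  iso_seg_bij : bijective fseg;
  iso_foot_bij : bijective ffoot;
  iso_sets_bij : bijective fsets;
  iso_seg_of : forall f, seg_of (ffoot f) = fseg (seg_of f);
  iso_hyperedges : forall H : {set seg M},
    (fseg @: H \in hyperedges N) = (H \in hyperedges M);
  iso_positive : forall P : {set foot M},
    (ffoot @: P \in positive N) = (P \in positive M);
  iso_sle : forall s t, sle (fseg s) (fseg t) = sle s t;
  iso_eps : forall s x, eps (fseg s) (fsets x) = eps s x;
  iso_shoe : ffoot (shoe M) = shoe N }.

Definition isomorphic (M N : shod_multipede4) : Prop :=
  exists fseg ffoot fsets, @isomorphism M N fseg ffoot fsets.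

(** * Pairs of multipedes as input structures *)

(** The relations of one multipede: its three sorts, the graph of [seg_of], the
    hyperedges and positive triples as ternary relations, [sle], [eps], and
    the shoe as a unary relation. *)
Inductive mrel :=
| RSeg | RFoot | RSets | RSegOf | RHyperedge | RPositive | RLe | REps | RShoe.

Definition mrels : seq mrel :=
  [:: RSeg; RFoot; RSets; RSegOf; RHyperedge; RPositive; RLe; REps; RShoe].

Definition mrel_code (R : mrel) : 'I_9 :=
  match R with
  | RSeg => inord 0 | RFoot => inord 1 | RSets => inord 2
  | RSegOf => inord 3 | RHyperedge => inord 4 | RPositive => inord 5
  | RLe => inord 6 | REps => inord 7 | RShoe => inord 8
  end.

Lemma mrel_codeK : cancel mrel_code (fun i => nth RSeg mrels i).
Proof. by case; rewrite /= inordK. Qed.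

HB.instance Definition _ := Finite.copy mrel (can_type mrel_codeK).

Definition mrel_arity (R : mrel) : nat :=
  match R with
  | RSeg | RFoot | RSets | RShoe => 1
  | RSegOf | RLe | REps => 2
  | RHyperedge | RPositive => 3
  end.

Definition melem (M : multipede4) : finType := (seg M + foot M + sets M)%type.

(** A list of three elements enumerates a hyperedge or a positive triple only
    if it has no repetition, as these have exactly three elements. *)
Definition mholds (M : shod_multipede4) (R : mrel) (xs : seq (melem M)) :
    bool :=
  match R, xs with
  | RSeg, [:: inl (inl _)] => true
  | RFoot, [:: inl (inr _)] => true
  | RSets, [:: inr _] => true
  | RSegOf, [:: inl (inr f); inl (inl s)] => seg_of f == s
  | RHyperedge, [:: inl (inl s); inl (inl t); inl (inl u)] =>
      [set s; t; u] \in hyperedges M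
  | RPositive, [:: inl (inr f); inl (inr g); inl (inr h)] =>
      [set f; g; h] \in positive M
  | RLe, [:: inl (inl s); inl (inl t)] => sle s t
  | REps, [:: inl (inl s); inr x] => eps s x
  | RShoe, [:: inl (inr f)] => f == shoe M
  | _, _ => false
  end.

(** Two copies of the vocabulary; [false] tags the first multipede. *)
Definition pair_vocabulary : vocabulary :=
  @Vocabulary (bool * mrel)%type (fun R => mrel_arity R.2).

Definition getl {T U : Type} (z : T + U) : option T :=
  if z is inl x then Some x else None.
Definition getr {T U : Type} (z : T + U) : option U :=
  if z is inr y then Some y else None.

(** The 6-sorted structure formed by two multipedes, on the disjoint union of
    the six sorts. *)
Definition pair_structure (MN : shod_multipede4 * shod_multipede4) :
    structure pair_vocabulary :=
  @Structure pair_vocabulary (melem MN.1 + melem MN.2)%type (fun R zs =>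
    if R.1 then all getr zs && mholds R.2 (pmap getr zs)
    else all getl zs && mholds R.2 (pmap getl zs)).

(* Main.v *)
From HB Require Import structures.
Require Import Defs.
From mathcomp Require Import all_boot all_algebra.
From mathcomp Require Import zify.

(** A multipede with n segments has 2^n elements of sort "sets", so polynomial
    bounds leave room for a brute force search over foot matchings. The program
    computes the least family that contains the empty matching and, with A,
    every A + (f, g) such that A already matches the feet strictly below f with
    the feet strictly below g. All matched pairs then lie over segments of the
    same rank; there are at most 4n such pairs, hence at most (2^n)^4 matchings
    and as many rounds before the family is stable. The graph of an
    isomorphism is built foot by foot in increasing order, so it belongs to the
    stable family. The converse needs only the two sorts below the sets: sets
    are determined by their members, and hyperedges are the images of the
    positive triples. *)

Set Implicit Arguments.
Unset Strict Implicit.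
Unset Printing Implicit Defensive.

(** * Truth values and unions among hereditarily finite sets *)

Lemma hf_bool_inj (A : countType) : injective (@hf_bool A).
Proof.
have neq01 : hf0 <> hfset [:: hf0] :> hf A.
  move/(congr1 elems) => e.
  have: (hf0 : hf A) \in elems (hfset [:: hf0]) by rewrite mem_hfset inE.
  by rewrite -e mem_hfset.
by case=> [] [] // e; case: neq01.
Qed.

Lemma istrueK V (I : structure V) b : istrue (hf_bool b : hf (dom I)) = b.
Proof. by rewrite /istrue (inj_eq (@hf_bool_inj _)); case: b. Qed.

Lemma mem_hf_union (A : countType) (x y : hf A) :
  (y \in elems (hf_union x)) = has (fun z => y \in elems z) (elems x).
Proof.
rewrite mem_hfset; apply/flatten_mapP/hasP => [] [z zx yz]; by exists z.
Qed.

(** * Programs that iterate a set term up to a fixed point *)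

Inductive fix_name := Family | Stop | Answer.

Definition fix_name_code (f : fix_name) : option bool :=
  match f with Family => None | Stop => Some false | Answer => Some true end.

Lemma fix_name_codeK : cancel fix_name_code
  (fun c => match c with
            | None => Family | Some false => Stop | Some true => Answer
            end).
Proof. by case. Qed.

HB.instance Definition _ := Finite.copy fix_name (can_type fix_name_codeK).

Definition fix_voc : dyn_vocabulary :=
  @DynVocabulary fix_name (fun=> 0) (predC1 Family) Stop Answer
    erefl erefl isT isT.

Section FixpointProgram.
Variables (V : vocabulary) (next out : term V fix_voc).

Definition fix_dyn (f : fix_name) : term V fix_voc :=
  @TDyn V fix_voc f [::].

Definition fix_set (f : fix_name) (t : term V fix_voc) : rule V fix_voc :=
  @Update V fix_voc f [::] t.

(* There is no parallel composition of two updates: the answer is written one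
   step before halting, and not at all if it is the initial value 0. *)
Definition fix_rule : rule V fix_voc :=
  If (TEq (fix_dyn Family) next)
    (If (TEq (fix_dyn Answer) out) (fix_set Stop (@TTrue _ _))
       (fix_set Answer out))
    (fix_set Family next).

Hypothesis wf_next : wf_term [::] next.
Hypothesis wf_out : wf_term [::] out.
Hypothesis boolean_out : boolean out.

Lemma wf_fix_rule : wf_rule [::] fix_rule.
Proof. by rewrite /= wf_next wf_out boolean_out. Qed.

Definition fix_program : program V := Program wf_fix_rule.

Section Run.
Variable I : structure V.
Local Notation obj := (hf (dom I)).

(** All dynamic functions are nullary, so locations with arguments keep the initial value [hf0]. *)
Definition fix_state (x : obj) (b h : bool) : state fix_voc I :=
  fun f xs => if xs is [::] then
    match f with Family => x | Stop => hf_bool h | Answer => hf_bool b end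
  else hf0.

(** [X] lists the successive values of [Family], [k] is the stage where they become stationary, and
    [b] is the verdict there. The evaluation hypotheses range over all states with the given
    [Family], so the two terms may not depend on the other dynamic functions. *)
Variables (X : nat -> obj) (k : nat) (b : bool).
Hypothesis X0 : X 0 = hf0.
Hypothesis Xlt : forall j, j < k -> X j <> X j.+1.
Hypothesis Xk : X k.+1 = X k.
Hypothesis eval_next : forall (A : state fix_voc I) j e,
  A Family [::] = X j -> eval A next e = X j.+1.
Hypothesis eval_out : forall (A : state fix_voc I) e,
  A Family [::] = X k -> eval A out e = hf_bool b.

Local Notation run_at := (@run V fix_voc I fix_rule).

Lemma fire1 (A : state fix_voc I) f (x : obj) g xs :
  fire [:: ((f : dynname fix_voc, [::]), x)] A g xs =
  if (f == g) && (xs == [::]) then x else A g xs.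
Proof.
rewrite /fire /consistent /= !eqxx /=.
by rewrite xpair_eqE [[::] == xs]eq_sym; case: ifP.
Qed.

(** The initial state has this form since [hf_bool false] is [hf0]. Before stage [k] consecutive
    values differ, so the guard fails and only [Family] is updated. *)
Lemma run_grow j : j <= k -> run_at j =2 fix_state (X j) false false.
Proof.
elim: j => [_ f [|//]|j IH lt_jk f xs]; first by case: f.
have {}IH := IH (ltnW lt_jk).
have -> : run_at j.+1 = step fix_rule (run_at j) by [].
rewrite /step /= !IH (eval_next (j := j)) ?IH //= istrueK.
case: eqP => [/(Xlt lt_jk) //|_].
by rewrite fire1 IH; case: f; case: xs.
Qed.

(** [k] rounds of growth, one step that sets [Stop], and one more to write the answer when [b] is
    true. *)
Definition fix_steps := k + b.+1.

Lemma run_stable :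
  (forall j, j < fix_steps -> ~~ halted (run_at j)) /\
  (forall j, k < j <= fix_steps ->
     run_at j =2 fix_state (X k) b (j == fix_steps)).
Proof.
(* One step at the fixed point, with current answer [o]: it corrects the answer if [o] differs from
   [b], and halts otherwise. *)
have stepE A o : A =2 fix_state (X k) o false ->
    step fix_rule A =2 fix_state (X k) b (o == b).
  move=> EA f xs; rewrite /step /= !EA (eval_next (j := k)) ?EA // Xk.
  rewrite eqxx istrueK (eval_out (A := A)) ?EA //= istrueK.
  rewrite (inj_eq (@hf_bool_inj _)); case: eqP => [ob|ob].
    by rewrite fire1 EA ob; case: f; case: xs.
  by rewrite fire1 EA; case: f; case: xs.
have S1 := stepE _ _ (run_grow (leqnn k)).
have R1 : run_at k.+1 =2 fix_state (X k) b (false == b).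
  by move=> f xs; rewrite -S1.
have nh j : j <= k -> ~~ halted (run_at j).
  by move=> le_jk; rewrite /halted run_grow //= (istrueK _ false).
rewrite /fix_steps; move: stepE R1; case: (b) => stepE R1.
  split=> j; last first.
    rewrite addn2 => /andP[lt_kj]; rewrite leq_eqVlt => /orP[/eqP->|].
      by rewrite eqxx; exact: stepE R1.
    rewrite ltnS => le_jk; have /eqP-> : j == k.+1 by rewrite eqn_leq le_jk.
    by move=> f xs; rewrite R1 (ltn_eqF (ltnSn _)).
  rewrite addn2 ltnS leq_eqVlt => /orP[/eqP->|/nh//].
  by rewrite /halted R1 /= (istrueK _ false).
split=> j; first by rewrite addn1; exact: nh.
rewrite addn1 => /andP[lt_kj le_jk]; have /eqP-> : j == k.+1 by rewrite eqn_leq le_jk.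
by move=> f xs; rewrite eqxx R1.
Qed.

(** A list closed under elements that contains the critical objects contains all active ones. The
    critical objects are atoms, truth values and stages [X j], because locations with arguments hold
    [hf0]. At most two steps follow stage [k]. *)
Lemma fix_program_answers (p q : {poly nat}) (l : seq obj) :
    k + 2 <= p.[#|dom I|]%R -> size l <= q.[#|dom I|]%R ->
    (forall x y, x \in l -> y \in elems x -> y \in l) ->
    (forall a, atom a \in l) -> hf_bool true \in l ->
    (forall j, j <= k -> X j \in l) ->
  answers (PTimeProgram fix_program p q) I b.
Proof.
move=> kp lq closed_l atoms_l true_l X_l; have [nh st] := run_stable.
have k_steps : k < fix_steps <= fix_steps.
  by rewrite /fix_steps -addSnnS leq_addr leqnn.
have false_l : hf_bool false \in l.
  by apply: closed_l true_l _; rewrite mem_hfset inE.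
exists fix_steps; split.
- by apply: leq_trans kp; rewrite /fix_steps leq_add2l; case: (b).
- by split=> //; rewrite /halted st // /= istrueK.
- exists l; split=> // j x le_j [y crit_y].
  have {crit_y} : y \in l.
    have stj : exists i o h, i <= k /\ run_at j =2 fix_state (X i) o h.
      have [le_jk|lt_kj] := leqP j k.
        by exists j, false, false; split=> // f xs; rewrite run_grow.
      exists k, b, (j == fix_steps); split=> // f xs; apply: st.
      by rewrite lt_kj.
    have [i [o [h [le_ik stE]]]] := stj.
    have bool_l c : hf_bool c \in l by case: c.
    case: crit_y => [[a ->] //|[c ->] //|[f [xs ->]]|[f [xs []]]]; rewrite stE.
      by case: xs => //; case: f => //=; exact: X_l.
    by case: xs.
  by move=> + tc; elim: tc => // {}x z _ IH xz /IH zl; apply: closed_l xz.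
- by rewrite /output st // /= istrueK.
Qed.

End Run.
End FixpointProgram.

(** * Finite sets coded as hereditarily finite sets, relative to a code of their elements *)

Definition encode (A : countType) (T : finType) (c : T -> hf A)
    (S : {set T}) : hf A :=
  hfset [seq c x | x <- enum S].

Section Encode.
Variables (A : countType) (T : finType) (c : T -> hf A).

Lemma encodeP (S : {set T}) y :
  reflect (exists2 x, x \in S & y = c x) (y \in elems (encode c S)).
Proof.
rewrite mem_hfset; apply: (iffP mapP) => [] [x xS ->]; exists x => //.
  by rewrite mem_enum in xS.
by rewrite mem_enum.
Qed.

Lemma encode_ext (S : {set T}) x : get_atom x = None ->
  (forall y, reflect (exists2 z, z \in S & y = c z) (y \in elems x)) ->
  x = encode c S.
Proof.
move=> nx xP; apply: hf_ext => //; first exact: get_atom_hfset.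
by move=> y; apply/xP/encodeP.
Qed.

Lemma mem_encode (S : {set T}) x : injective c ->
  (c x \in elems (encode c S)) = (x \in S).
Proof.
move=> inj_c; apply/encodeP/idP => [[y yS /inj_c -> //]|xS]; by exists x.
Qed.

Lemma encode_inj : injective c -> injective (encode c).
Proof.
by move=> inj_c S S' e; apply/setP=> x; rewrite -!(mem_encode _ _ inj_c) e.
Qed.

Lemma encode0 : encode c set0 = hf0.
Proof. by rewrite /encode enum_set0. Qed.

End Encode.

(** * Stabilization of increasing chains of finite sets *)

Section Chain.
Variables (T : finType) (G : {set T} -> {set T}) (B : {set T}).
Hypothesis G_mono : {homo G : S S' / S \subset S'}.
Hypothesis G_bound : forall j, iter j G set0 \subset B.

Lemma iter_grows j : iter j G set0 \subset iter j.+1 G set0.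
Proof. by elim: j => [|j IH]; [exact: sub0set | exact: G_mono IH]. Qed.

(** Every unstable stage gains an element in the next one, and all stages lie in [B]. Taking the
    least stable index makes consecutive earlier stages distinct. *)
Lemma iter_stabilizes : exists k, [/\ k <= #|B|,
  forall j, j < k -> iter j G set0 <> iter j.+1 G set0
  & iter k.+1 G set0 = iter k G set0].
Proof.
pose stable j := iter j.+1 G set0 == iter j G set0.
have [j le_jB st_j] : exists2 j, j <= #|B| & stable j.
  case: (pickP (fun j : 'I_(#|B|.+1) => stable j)) => [j|unst].
    by exists j => //; rewrite -ltnS.
  (* If the first [#|B|.+1] steps were all strict, stage [#|B|.+1] would be larger than [B]. *)
  have card_ge j : j <= #|B|.+1 -> j <= #|iter j G set0|.
    elim: j => // j IH lt_j; apply: leq_ltn_trans (IH (ltnW lt_j)) _.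
    apply: proper_card; rewrite properEneq iter_grows andbT eq_sym.
    by have /= := unst (Ordinal lt_j); rewrite /stable => ->.
  have := leq_trans (card_ge _ (leqnn _)) (subset_leq_card (G_bound _)).
  by rewrite ltnn.
have ex_stable : exists j, stable j by exists j.
case: (ex_minnP ex_stable) => k /eqP st_k min_k; exists k; split=> //.
  exact: leq_trans (min_k _ st_j) le_jB.
by move=> i lt_ik /esym/eqP/min_k; rewrite leqNgt lt_ik.
Qed.

End Chain.

(** * Quantifiers and set operations as derived terms *)

Section Terms.
Variables (V : vocabulary) (D : dyn_vocabulary).
Local Notation term := (term V D).

Definition t_imp (t u : term) : term := TOr (TNot t) u.

(** The comprehension collects the constant value [hf0], so it is nonempty exactly when some element
    of [r] satisfies [t]. *)
Definition t_ex v (r t : term) : term :=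
  TNot (TEq (TCompr v (@TEmpty V D) r t) (@TEmpty V D)).

Definition t_all v (r t : term) : term := TNot (t_ex v r (TNot t)).

Definition t_bigcup v (r t : term) : term :=
  TUnion (TCompr v t r (@TTrue V D)).

Definition t_cup (t u : term) : term := TUnion (TPair t u).

Definition t_sing (t : term) : term := TPair t t.

Variables (I : structure V) (A : state D I).
Implicit Types (t u r : term) (e : valuation I).

Lemma eval_not t e b : eval A t e = hf_bool b ->
  eval A (TNot t) e = hf_bool (~~ b).
Proof. by move=> /= ->; rewrite istrueK. Qed.

Lemma eval_and t u e b c : eval A t e = hf_bool b -> eval A u e = hf_bool c ->
  eval A (TAnd t u) e = hf_bool (b && c).
Proof. by move=> /= -> ->; rewrite !istrueK. Qed.

Lemma eval_imp t u e b c : eval A t e = hf_bool b -> eval A u e = hf_bool c ->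
  eval A (t_imp t u) e = hf_bool (b ==> c).
Proof. by move=> /= -> ->; rewrite !istrueK implybE. Qed.

Lemma eval_iff t u e b c : eval A t e = hf_bool b -> eval A u e = hf_bool c ->
  eval A (TEq t u) e = hf_bool (b == c).
Proof. by move=> /= -> ->; rewrite (inj_eq (@hf_bool_inj _)). Qed.

Section Quantifiers.
Variables (T : finType) (c : T -> hf (dom I)) (S : {set T}).
Variables (v : nat) (r t : term) (e : valuation I) (P : pred T).
Hypothesis rE : eval A r e = encode c S.

Lemma eval_ex_in :
  (forall x, x \in S -> eval A t (assign e v (c x)) = hf_bool (P x)) ->
  eval A (t_ex v r t) e = hf_bool [exists x in S, P x].
Proof.
move=> tE; rewrite /= rE.
set s := map _ _; suff -> : (hfset s == hf0) = ~~ [exists x in S, P x].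
  by rewrite istrueK negbK.
apply/eqP/idP => [s0|nP].
  apply/negP => /existsP[x /andP[xS Px]].
  suff: hf0 \in elems (hfset s) by rewrite s0 mem_hfset.
  rewrite mem_hfset; apply/mapP; exists (c x) => //.
  by rewrite mem_filter tE // istrueK Px; apply/encodeP; exists x.
suff /eqP/size0nil -> : size s == 0 by [].
rewrite size_map size_filter -leqn0 leqNgt -has_count.
apply: contra nP => /hasP[y /encodeP[x xS ->]]; rewrite tE // istrueK => Px.
by apply/existsP; exists x; rewrite xS.
Qed.

End Quantifiers.

Lemma eval_all_in (T : finType) (c : T -> hf (dom I)) (S : {set T}) v r t e P :
  eval A r e = encode c S ->
  (forall x, x \in S -> eval A t (assign e v (c x)) = hf_bool (P x)) ->
  eval A (t_all v r t) e = hf_bool [forall x in S, P x].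
Proof.
move=> rE tE.
rewrite (eval_not (eval_ex_in (P := fun x => ~~ P x) rE _)); last first.
  by move=> x xS; apply: eval_not; exact: tE.
congr hf_bool; apply/existsPn/'forall_implyP => nP x; have := nP x.
  by move=> + xS; rewrite xS /= negbK.
by case: (x \in S) => //= ->.
Qed.

Lemma mem_bigcup (T : finType) (c : T -> hf (dom I)) (S : {set T}) v r t e y :
  eval A r e = encode c S ->
  reflect (exists2 x, x \in S & y \in elems (eval A t (assign e v (c x))))
    (y \in elems (eval A (t_bigcup v r t) e)).
Proof.
move=> rE; rewrite /= rE mem_hf_union.
apply: (iffP hasP) => [[z]|[x xS yx]].
  rewrite mem_hfset => /mapP[w]; rewrite mem_filter => /andP[_ /encodeP[x xS ->]].
  by move=> ->; exists x.
exists (eval A t (assign e v (c x))) => //; rewrite mem_hfset; apply: map_f.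
by rewrite mem_filter (istrueK I true); apply/encodeP; exists x.
Qed.

Lemma mem_compr (T : finType) (c : T -> hf (dom I)) (S : {set T}) v r t g e y P :
  eval A r e = encode c S ->
  (forall x, x \in S -> eval A g (assign e v (c x)) = hf_bool (P x)) ->
  reflect (exists2 x, (x \in S) && P x & y = eval A t (assign e v (c x)))
    (y \in elems (eval A (TCompr v t r g) e)).
Proof.
move=> rE gE; rewrite /= rE mem_hfset.
apply: (iffP mapP) => [[z]|[x /andP[xS Px] ->]].
  rewrite mem_filter andbC => /andP[/encodeP[x xS ->]].
  by rewrite gE // istrueK => Px ->; exists x; rewrite ?xS.
by exists (c x) => //; rewrite mem_filter gE // istrueK Px; apply/encodeP; exists x.
Qed.

Lemma mem_cup t u e y : (y \in elems (eval A (t_cup t u) e)) =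
  (y \in elems (eval A t e)) || (y \in elems (eval A u e)).
Proof.
rewrite /= mem_hf_union; apply/hasP/orP => [[z]|].
  by rewrite mem_hfset !inE => /orP[] /eqP ->; [left|right].
by case=> yz; [exists (eval A t e)|exists (eval A u e)];
  rewrite // mem_hfset !inE eqxx ?orbT.
Qed.

Lemma mem_sing t e y : (y \in elems (eval A (t_sing t) e)) = (y == eval A t e).
Proof. by rewrite /= mem_hfset !inE orbb. Qed.

End Terms.

(** * Combinatorics of one multipede: triples, ranks, feet and sets *)

Lemma imset_set3 (T U : finType) (h : T -> U) x y z :
  h @: [set x; y; z] = [set h x; h y; h z].
Proof. by rewrite !imsetU !imset_set1. Qed.

Lemma card3_set3 (T : finType) (S : {set T}) :
  #|S| = 3 -> exists x y z, S = [set x; y; z].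
Proof.
move=> S3; have /card_gt0P[x xS] : 0 < #|S| by rewrite S3.
have : #|S :\ x| == 2 by rewrite -eqSS -S3 [#|S|](cardsD1 x) xS.
case/cards2P=> y [z [_ e]]; exists x, y, z.
by rewrite -(setD1K xS) e setUA.
Qed.

Section Segments.
Variable M : multipede3.
Implicit Types s t : seg M.

(** The position of [s] in the order, counted from 0: by totality [~~ sle s t] says that [t] is
    strictly below [s]. Unlike segments, ranks can be compared across two multipedes. *)
Definition rank s := #|[set t | ~~ sle s t]|.

Lemma rank_lt s t : ~~ sle s t -> rank t < rank s.
Proof.
move=> nst; have ts : sle t s by case/orP: (sle_total s t) nst => ->.
apply/proper_card/properP; split.
  apply/subsetP => u; rewrite !inE; apply: contra => su.
  exact: sle_trans ts su.
by exists t; rewrite inE ?sle_refl.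
Qed.

Lemma rank_inj : injective rank.
Proof.
move=> s t e; apply: sle_anti; apply/andP.
by split; apply/negPn/negP => /rank_lt; rewrite e ltnn.
Qed.

(** The strict order of the underlying segments; the two feet of one segment are incomparable. *)
Definition foot_lt (f g : foot M) := ~~ sle (seg_of g) (seg_of f).

Lemma seg_foot s : exists f : foot M, seg_of f == s.
Proof.
have: 0 < #|[set f | seg_of f == s]| by rewrite two_feet.
by case/card_gt0P => f; rewrite inE; exists f.
Qed.

Definition foot_of s := xchoose (seg_foot s).

Lemma foot_ofK s : seg_of (foot_of s) = s.
Proof. exact/eqP/(xchooseP (seg_foot s)). Qed.

Lemma card_foot : #|foot M| = 2 * #|seg M|.
Proof.
rewrite -sum1_card (partition_big (@seg_of M) predT) //=.
rewrite (eq_bigr (fun=> 2)) => [|s _]; last first.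
  by rewrite -(two_feet s) -sum1_card; apply: eq_bigl => f; rewrite inE.
by rewrite sum_nat_const mulnC.
Qed.

(** Of the four positive triples over a hyperedge any one will do, so the positive triples determine
    the hyperedges. *)
Lemma hyperedgeP (H : {set seg M}) :
  reflect (exists2 P, P \in positive M & H = @seg_of _ @: P) (H \in hyperedges M).
Proof.
apply: (iffP idP) => [/four_positive H4|[P posP ->]]; last first.
  exact: positive_hyperedge.
have /card_gt0P[P] : 0 < #|[set P in positive M | @seg_of _ @: P == H]| by rewrite H4.
by rewrite inE => /andP[posP /eqP <-]; exists P.
Qed.

End Segments.

(** Choosing a representing element for each set of segments is injective, since that element
    determines its members. The input is thus exponentially large in the number of segments. *)
Lemma card_sets (M : multipede4) : 2 ^ #|seg M| <= #|sets M|.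
Proof.
have exX (X : {set seg M}) : exists x : sets M, X == [set s | eps s x].
  by have [x [/eqP]] := eps_unique X; exists x.
pose h X := xchoose (exX X); suff: injective h.
  by move/leq_card; rewrite -cardsT -powersetT card_powerset cardsT.
move=> X Y e; rewrite (eqP (xchooseP (exX X))) -[xchoose _]/(h X) e.
by rewrite -(eqP (xchooseP (exX Y))).
Qed.

(** * Partial matchings between the feet of two multipedes *)

Section Pairs.
Variables M N : shod_multipede4.
Local Notation pair_type := (foot M * foot N)%type.
Implicit Types (A : {set pair_type}) (F : {set {set pair_type}}).

(** Each foot below one component must have some partner below the other; single-valuedness is
    tested later, by [good]. *)
Definition extendable A (p : pair_type) : bool :=
  [forall f, foot_lt f p.1 ==> [exists g, foot_lt g p.2 && ((f, g) \in A)]] &&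
  [forall g, foot_lt g p.2 ==> [exists f, foot_lt f p.1 && ((f, g) \in A)]].

(** Iteration starts from the empty family, coded by the initial value [hf0] of [Family]; the empty
    matching enters in the first round. *)
Definition extend F : {set {set pair_type}} :=
  [set B | (B == set0) ||
           [exists A in F, exists p, extendable A p && (B == p |: A)]].

Lemma extend_mono : {homo extend : F F' / F \subset F'}.
Proof.
move=> F F' /subsetP FF'; apply/subsetP => B; rewrite !inE.
case: eqP => //= _ /existsP[A /andP[/FF' AF' AB]].
by apply/existsP; exists A; rewrite AF'.
Qed.

Definition same_rank : {set pair_type} :=
  [set p | rank (seg_of p.1) == rank (seg_of p.2)].

(** Ranks are injective in [N], so the partners of a foot of [M] are at most the two feet of one
    segment; and [M] has twice as many feet as segments. *)
Lemma card_same_rank : #|same_rank| <= 4 * #|seg M|.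
Proof.
apply: (@leq_trans (\sum_(f : foot M) 2)); last first.
  by rewrite sum_nat_const card_foot; lia.
rewrite -sum1_card (eq_bigl (fun p : pair_type =>
  true && (rank (seg_of p.1) == rank (seg_of p.2)))); last first.
  by move=> p; rewrite inE.
rewrite -(pair_big_dep predT
  (fun f g => rank (seg_of f) == rank (seg_of g)) (fun _ _ => 1)) /=.
apply: leq_sum => f _; rewrite sum1dep_card.
have [g /eqP fg|none] := pickP (fun g : foot N =>
  rank (seg_of f) == rank (seg_of g)); last by rewrite eq_card0 // => g; rewrite inE none.
rewrite -(two_feet (seg_of g)); apply/subset_leq_card/subsetP => g'.
by rewrite !inE fg => /eqP/rank_inj ->.
Qed.

(** Matched feet have equal rank, so the same ranks occur below both components of [p]. A rank
    counts the segments below, and distinct segments have distinct ranks. *)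
Lemma extendable_same_rank A p :
  A \subset same_rank -> extendable A p -> p \in same_rank.
Proof.
move=> /subsetP Asr /andP[/forallP fwd /forallP bwd]; rewrite inE.
have size_below (K : multipede3) (s : seg K) :
    rank s = size [seq rank t | t <- enum [set t | ~~ sle s t]].
  by rewrite size_map -cardE.
have uniq_below (K : multipede3) (s : seg K) :
    uniq [seq rank t | t <- enum [set t | ~~ sle s t]].
  by rewrite map_inj_uniq ?enum_uniq //; exact: rank_inj.
(* Each inequality becomes an inclusion of duplicate-free lists of ranks. *)
rewrite eqn_leq !size_below; apply/andP; split; apply: uniq_leq_size => // r.
  case/mapP=> t; rewrite mem_enum inE => tlt ->.
  have /implyP := fwd (foot_of t); rewrite /foot_lt foot_ofK => /(_ tlt).
  case/existsP=> g /andP[glt /Asr]; rewrite inE /= foot_ofK => /eqP ->.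
  by apply: map_f; rewrite mem_enum inE.
case/mapP=> t; rewrite mem_enum inE => tlt ->.
have /implyP := bwd (foot_of t); rewrite /foot_lt foot_ofK => /(_ tlt).
case/existsP=> g /andP[glt /Asr]; rewrite inE /= foot_ofK => /eqP <-.
by apply: map_f; rewrite mem_enum inE.
Qed.

Lemma iter_extend_same_rank j :
  iter j extend set0 \subset powerset same_rank.
Proof.
elim: j => [|j /subsetP IH]; first exact: sub0set.
apply/subsetP => B; rewrite iterS inE => /orP[/eqP->|].
  by rewrite inE sub0set.
case/existsP=> A /andP[/IH]; rewrite inE => Asr /existsP[p /andP[Ap /eqP->]].
by rewrite inE subUset sub1set Asr (extendable_same_rank Asr Ap).
Qed.

(** Comparing [f == f'] with [g == g'] makes the matching single-valued and injective; comparing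
    [sle] lets it descend to segments. *)
Definition good A : bool :=
  [&& [forall f, exists g, (f, g) \in A],
      [forall g, exists f, (f, g) \in A]
    & [forall f, forall g, ((f, g) \in A) ==>
        [&& (f == shoe M) == (g == shoe N)
          & [forall f', forall g', ((f', g') \in A) ==>
              [&& (f == f') == (g == g'),
                  sle (seg_of f) (seg_of f') == sle (seg_of g) (seg_of g')
                & [forall f'', forall g'', ((f'', g'') \in A) ==>
                    (([set f; f'; f''] \in positive M) ==
                     ([set g; g'; g''] \in positive N))]]]]]].

(** A largest member of [F] inside the graph of the isomorphism on feet is the whole graph:
    otherwise a lowest unmatched foot could still be added with its image. *)
Lemma isomorphic_good F :
  isomorphic M N -> extend F \subset F -> [exists A in F, good A].
Proof.
case=> fseg [h [fsets iso]] /subsetP FF.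
have [h' hK h'K] := iso_foot_bij iso.
have sle_h f f' : sle (seg_of (h f)) (seg_of (h f')) = sle (seg_of f) (seg_of f').
  by rewrite !(iso_seg_of iso) (iso_sle iso).
pose graph := [set p : pair_type | p.2 == h p.1].
have good_graph : good graph.
  apply/and3P; split.
  - by apply/forallP => f; apply/existsP; exists (h f); rewrite inE.
  - by apply/forallP => g; apply/existsP; exists (h' g); rewrite inE /= h'K.
  apply/'forall_forallP => f g; rewrite inE; apply/implyP => /eqP /= ->.
  rewrite -(iso_shoe iso) (inj_eq (can_inj hK)) eqxx /=.
  apply/'forall_forallP => f' g'; rewrite inE; apply/implyP => /eqP /= ->.
  rewrite (inj_eq (can_inj hK)) sle_h !eqxx /=.
  apply/'forall_forallP => f'' g''; rewrite inE; apply/implyP => /eqP /= ->.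
  by rewrite -imset_set3 (iso_positive iso).
have F0 : (set0 \in F) && (set0 \subset graph).
  by rewrite sub0set andbT FF // inE eqxx.
case: (arg_maxnP (P := fun A => (A \in F) && (A \subset graph))
   (fun A => #|A|) F0) => A /andP[AF /subsetP Agr] maxA.
apply/existsP; exists A; rewrite AF /=.
suff -> : A = graph by [].
apply/eqP; rewrite eqEsubset; apply/andP; split; apply/subsetP => //.
move=> [f0 g0]; rewrite inE => /eqP /= ->; apply/negPn/negP => f0A.
(* Among the unmatched feet take one of least rank; every foot strictly below it is then matched
   with its image. *)
case: (@arg_minnP _ f0 (fun f => (f, h f) \notin A) (fun f => rank (seg_of f)) f0A).
move=> f fA minf.
have below f' : foot_lt f' f -> (f', h f') \in A.
  by move/rank_lt => lt; apply: contraLR lt => /minf; rewrite leqNgt.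
have ext : extendable A (f, h f).
  apply/andP; split; apply/forallP => g'; apply/implyP => /= lt.
    by apply/existsP; exists (h g'); rewrite below // andbT /foot_lt sle_h.
  rewrite -(h'K g') /foot_lt sle_h in lt.
  by apply/existsP; exists (h' g'); have := below _ lt; rewrite h'K => ->; rewrite andbT.
have: (f, h f) |: A \in F.
  rewrite FF // inE; apply/orP; right; apply/existsP; exists A.
  by rewrite AF; apply/existsP; exists (f, h f); rewrite ext eqxx.
move=> fAF; have := maxA ((f, h f) |: A); rewrite fAF subUset sub1set inE eqxx /=.
have -> : A \subset graph by apply/subsetP.
by move=> /(_ isT); rewrite cardsU1 fA add1n ltnn.
Qed.

(** The partners define mutually inverse maps on feet. The segment map acts through a foot over the
    segment, and the map on sets sends a set to the element representing its image. *)
Lemma good_isomorphic A : good A -> isomorphic M N.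
Proof.
case/and3P=> /forallP tot /forallP onto /'forall_forallP goodA.
have tot' f : exists g, (f, g) \in A by exact/existsP.
have onto' g : exists f, (f, g) \in A by exact/existsP.
pose h f := xchoose (tot' f); pose h' g := xchoose (onto' g).
have hA f : (f, h f) \in A := xchooseP (tot' f).
have h'A g : (h' g, g) \in A := xchooseP (onto' g).
have {goodA} goodA f f' f'' g g' g'' : (f, g) \in A -> (f', g') \in A ->
  (f'', g'') \in A ->
  [/\ (f == shoe M) = (g == shoe N), (f == f') = (g == g'),
      sle (seg_of f) (seg_of f') = sle (seg_of g) (seg_of g')
    & ([set f; f'; f''] \in positive M) = ([set g; g'; g''] \in positive N)].
  move=> fg fg' fg''; have /implyP /(_ fg) /andP[/eqP-> /'forall_forallP] := goodA f g.
  move=> /(_ f' g') /implyP /(_ fg') /and3P[/eqP-> /eqP->] /'forall_forallP.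
  by move=> /(_ f'' g'') /implyP /(_ fg'') /eqP ->.
have eqA f f' g g' : (f, g) \in A -> (f', g') \in A -> (f == f') = (g == g').
  by move=> fg fg'; have [] := goodA _ _ _ _ _ _ fg fg' fg'.
have hK : cancel h h' by move=> f; apply/eqP; rewrite (eqA _ _ _ _ (h'A _) (hA _)).
have h'K : cancel h' h by move=> g; apply/eqP; rewrite -(eqA _ _ _ _ (hA _) (h'A _)).
have sle_h f f' : sle (seg_of (h f)) (seg_of (h f')) = sle (seg_of f) (seg_of f').
  by have [_ _ ->] := goodA _ _ _ _ _ _ (hA f) (hA f') (hA f').
(* [foot_of] is an arbitrary choice; since [h] preserves [sle] in both directions, antisymmetry
   makes the result independent of it. *)
pose k s := seg_of (h (foot_of s)); pose k' t := seg_of (h' (foot_of t)).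
have kE f : seg_of (h f) = k (seg_of f).
  by apply: sle_anti; rewrite !sle_h foot_ofK !sle_refl.
have sle_k s t : sle (k s) (k t) = sle s t by rewrite sle_h !foot_ofK.
have kK : cancel k k'.
  move=> s; apply: sle_anti.
  by rewrite -!sle_k -!kE !h'K !foot_ofK !sle_refl.
have k'K : cancel k' k by move=> t; rewrite -kE h'K foot_ofK.
have pos_h (P : {set foot M}) : (h @: P \in positive N) = (P \in positive M).
  (* [good] only speaks of sets listed by three feet; a set whose size is not 3 is positive on
     neither side. *)
  have [/card3_set3[x [y [z ->]]]|nP] := eqVneq #|P| 3.
    by rewrite imset_set3; have [_ _ _ ->] := goodA _ _ _ _ _ _ (hA x) (hA y) (hA z).
  apply/idP/idP => /card_positive /eqP; last by rewrite (negbTE nP).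
  by rewrite (card_imset _ (can_inj hK)) (negbTE nP).
have seg_h (P : {set foot M}) : @seg_of _ @: (h @: P) = k @: (@seg_of _ @: P).
  by rewrite -!imset_comp; apply: eq_imset => f; exact: kE.
have exX (M' : shod_multipede4) (X : {set seg M'}) : exists x, X == [set s | eps s x].
  by have [x [/eqP]] := eps_unique X; exists x.
have eps_inj (M' : shod_multipede4) (x y : sets M') :
    [set s | eps s x] = [set s | eps s y] -> x = y.
  move=> e; have [z [_ zu]] := eps_unique [set s | eps s x].
  by rewrite -(zu x) // (zu y).
pose u x := xchoose (exX N (k @: [set s | eps s x])).
pose u' y := xchoose (exX M (k' @: [set s | eps s y])).
have uE x : [set s | eps s (u x)] = k @: [set s | eps s x].
  exact/esym/eqP/(xchooseP (exX N _)).
have u'E y : [set s | eps s (u' y)] = k' @: [set s | eps s y].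
  exact/esym/eqP/(xchooseP (exX M _)).
exists k, h, u; split.
- by exists k'.
- by exists h'.
- exists u'.
    move=> x; apply: eps_inj; rewrite u'E uE -imset_comp -[RHS]imset_id.
    by apply: eq_imset => s; exact: kK.
  move=> y; apply: eps_inj; rewrite uE u'E -imset_comp -[RHS]imset_id.
  by apply: eq_imset => s; exact: k'K.
- exact: kE.
- move=> H; apply/hyperedgeP/hyperedgeP => [] [P posP].
    (* A positive triple of [N] is the image of its pullback along [h'], and [k] is injective on
       sets of segments. *)
    have PE : h @: (h' @: P) = P.
      by rewrite -imset_comp -[RHS]imset_id; apply: eq_imset => g; exact: h'K.
    rewrite -PE seg_h => /(imset_inj (can_inj kK)) ->.
    by exists (h' @: P); rewrite // -pos_h PE.
  by move=> ->; exists (h @: P); rewrite ?pos_h ?seg_h.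
- exact: pos_h.
- exact: sle_k.
- move=> s x; have : (k s \in [set s | eps s (u x)]) = (k s \in k @: [set s | eps s x]).
    by rewrite uE.
  by rewrite (mem_imset _ _ (can_inj kK)) !inE.
- apply/eqP.
  by have [<- _ _ _] := goodA _ _ _ _ _ _ (hA (shoe M)) (hA (shoe M)) (hA (shoe M)).
Qed.

End Pairs.

(** * The terms of the isomorphism program *)

Lemma atom_inj (A : countType) : injective (@atom A).
Proof. exact: pcan_inj (@atomK A). Qed.

Section PairTerms.
Local Notation var := (@TVar pair_vocabulary fix_voc).
Local Notation pair_term := (term pair_vocabulary fix_voc).

Definition t_rel (b : bool) (R : mrel) (vs : seq nat) : pair_term :=
  @TInput pair_vocabulary fix_voc (b, R) (map var vs).

Definition t_sort (b : bool) (R : mrel) : pair_term :=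
  TCompr 0 (var 0) (@TAtoms _ _) (t_rel b R [:: 0]).

(* Variable 0 ranges over matchings, 1, 3, 5 over feet of the first multipede,
   2, 4, 6 over feet of the second, and 20, 21 over segments. *)
Definition t_le (b : bool) (x y : nat) : pair_term :=
  t_ex 20 (t_sort b RSeg) (t_ex 21 (t_sort b RSeg)
    (TAnd (t_rel b RSegOf [:: x; 20])
       (TAnd (t_rel b RSegOf [:: y; 21]) (t_rel b RLe [:: 20; 21])))).

Definition t_lt (b : bool) (x y : nat) : pair_term := TNot (t_le b y x).

Definition t_matched (x y : nat) : pair_term :=
  TIn (TPair (var x) (var y)) (var 0).

Definition t_extendable : pair_term :=
  TAnd
    (t_all 3 (t_sort false RFoot) (t_imp (t_lt false 3 1)
       (t_ex 4 (t_sort true RFoot) (TAnd (t_lt true 4 2) (t_matched 3 4)))))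
    (t_all 4 (t_sort true RFoot) (t_imp (t_lt true 4 2)
       (t_ex 3 (t_sort false RFoot) (TAnd (t_lt false 3 1) (t_matched 3 4))))).

(** A comprehension binds one variable, so the matching and the foot of the first multipede are
    chosen by nested unions. *)
Definition t_extend : pair_term :=
  t_cup (t_sing (@TEmpty _ _))
    (t_bigcup 0 (fix_dyn _ Family) (t_bigcup 1 (t_sort false RFoot)
       (TCompr 2 (t_cup (t_sing (TPair (var 1) (var 2))) (var 0))
          (t_sort true RFoot) t_extendable))).

Definition t_good : pair_term :=
  TAnd (t_all 1 (t_sort false RFoot)
          (t_ex 2 (t_sort true RFoot) (t_matched 1 2)))
 (TAnd (t_all 2 (t_sort true RFoot)
          (t_ex 1 (t_sort false RFoot) (t_matched 1 2)))
  (t_all 1 (t_sort false RFoot) (t_all 2 (t_sort true RFoot)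
    (t_imp (t_matched 1 2)
      (TAnd (TEq (t_rel false RShoe [:: 1]) (t_rel true RShoe [:: 2]))
        (t_all 3 (t_sort false RFoot) (t_all 4 (t_sort true RFoot)
          (t_imp (t_matched 3 4)
            (TAnd (TEq (TEq (var 1) (var 3)) (TEq (var 2) (var 4)))
            (TAnd (TEq (t_le false 1 3) (t_le true 2 4))
              (t_all 5 (t_sort false RFoot) (t_all 6 (t_sort true RFoot)
                (t_imp (t_matched 5 6)
                  (TEq (t_rel false RPositive [:: 1; 3; 5])
                     (t_rel true RPositive [:: 2; 4; 6]))))))))))))))).

Definition t_answer : pair_term := t_ex 0 (fix_dyn _ Family) t_good.

Definition isomorphism_program : program pair_vocabulary :=
  @fix_program pair_vocabulary t_extend t_answer isT isT isT.

(** * Values of the terms on a pair of multipedes *)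

Section Eval.
Variable MN : shod_multipede4 * shod_multipede4.
Local Notation I := (pair_structure MN).
Local Notation obj := (hf (dom I)).
Local Notation pair_type := (foot MN.1 * foot MN.2)%type.

Definition side (b : bool) : shod_multipede4 := if b then MN.2 else MN.1.

Definition elem (b : bool) : melem (side b) -> dom I :=
  match b with false => inl | true => inr end.

Definition seg_obj b (s : seg (side b)) : obj := atom (elem (inl (inl s))).
Definition foot_obj b (f : foot (side b)) : obj := atom (elem (inl (inr f))).

(** An unordered pair suffices: its components are atoms from different summands of the domain. *)
Definition pair_obj (p : pair_type) : obj :=
  hfset [:: @foot_obj false p.1; @foot_obj true p.2].

Definition match_obj : {set pair_type} -> obj := encode pair_obj.

Lemma elem_inj b : injective (@elem b).
Proof. by case: b => x y []. Qed.

Lemma foot_obj_inj b : injective (@foot_obj b).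
Proof. by move=> f g /atom_inj/elem_inj []. Qed.

Lemma pair_obj_inj : injective pair_obj.
Proof.
move=> [f g] [f' g'] /(congr1 elems) e.
have: @foot_obj false f \in elems (pair_obj (f', g')).
  by rewrite -e mem_hfset inE eqxx.
have: @foot_obj true g \in elems (pair_obj (f', g')).
  by rewrite -e mem_hfset !inE eqxx orbT.
have ft_neq (f1 : foot MN.1) (g1 : foot MN.2) :
    @foot_obj false f1 <> @foot_obj true g1 by move=> /atom_inj.
rewrite !mem_hfset !inE => /orP[/eqP/esym/ft_neq//|/eqP/foot_obj_inj->].
by case/orP=> [/eqP/foot_obj_inj->|/eqP/ft_neq].
Qed.

Lemma match_obj_inj : injective match_obj.
Proof. exact/encode_inj/pair_obj_inj. Qed.

Variable A : state fix_voc I.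
Implicit Types (t : pair_term) (e : valuation I).

Lemma eval_rel b R vs (zs : seq (melem (side b))) e :
  map e vs = [seq atom (elem z) | z <- zs] ->
  eval A (t_rel b R vs) e = hf_bool (mholds R zs).
Proof.
move=> ez; rewrite /= -map_comp (eq_map (_ : _ =1 e)) // ez; congr hf_bool.
rewrite /input_holds all_map all_predT /=.
have -> : pmap get_atom [seq atom (elem z) | z <- zs] = map (@elem b) zs.
  by elim: (zs) => //= z s ->.
case: b zs {ez} => zs /=.
  have -> : all getr (map (@elem true) zs) by rewrite all_map all_predT.
  by congr mholds; elim: zs => //= z s ->.
have -> : all getl (map (@elem false) zs) by rewrite all_map all_predT.
by congr mholds; elim: zs => //= z s ->.
Qed.

Lemma eval_sort (T : finType) b R (h : T -> melem (side b)) e :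
  (forall z, reflect (exists x, z = h x) (mholds R [:: z])) ->
  eval A (t_sort b R) e = encode (fun x => atom (elem (h x))) [set: T].
Proof.
move=> hP; apply: encode_ext => [|y]; first exact: get_atom_hfset.
have atomsE : eval A (@TAtoms _ _) e = encode (@atom (dom I)) [set: dom I].
  apply: encode_ext => [|z]; first exact: get_atom_hfset.
  rewrite mem_hfset; apply: (iffP mapP) => [[a _ ->]|[a _ ->]]; exists a => //.
  by rewrite mem_enum.
pose P a := @input_holds _ I (b, R) [:: (@atom (dom I)) a].
apply: (iffP (mem_compr (P := P) _ _ atomsE _)) => [a _ //|[a /= Pa ->]|[x _ ->]].
  (* A relation tagged [b] holds only of atoms from that side. *)
  have [z az] : exists z : melem (side b), a = elem z.
    move: Pa; rewrite inE /P /input_holds /=.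
    by case: b {h hP P} a => -[] z // _; exists z.
  move: Pa; rewrite inE /P az.
  have := @eval_rel b R [:: 0] [:: z] (fun=> atom (elem z)) erefl.
  by move=> /= /hf_bool_inj -> /hP[x ->]; exists x.
exists (elem (h x)) => //; rewrite inE /P.
have := @eval_rel b R [:: 0] [:: h x] (fun=> atom (elem (h x))) erefl.
by move=> /= /hf_bool_inj ->; apply/hP; exists x.
Qed.

Lemma eval_feet b e : eval A (t_sort b RFoot) e = encode (@foot_obj b) setT.
Proof.
apply: eval_sort => -[[s|f]|x]; constructor; try by case.
by exists f.
Qed.

Lemma eval_segs b e : eval A (t_sort b RSeg) e = encode (@seg_obj b) setT.
Proof.
apply: eval_sort => -[[s|f]|x]; constructor; try by case.
by exists s.
Qed.

Lemma eval_ex_foot b v t e P :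
  (forall f, eval A t (assign e v (@foot_obj b f)) = hf_bool (P f)) ->
  eval A (t_ex v (t_sort b RFoot) t) e = hf_bool [exists f, P f].
Proof.
move=> tE; rewrite (eval_ex_in (eval_feet b e) (P := P)) => [|x _]; last exact: tE.
by congr hf_bool; apply: eq_existsb => f; rewrite inE.
Qed.

Lemma eval_all_foot b v t e P :
  (forall f, eval A t (assign e v (@foot_obj b f)) = hf_bool (P f)) ->
  eval A (t_all v (t_sort b RFoot) t) e = hf_bool [forall f, P f].
Proof.
move=> tE; rewrite (eval_all_in (eval_feet b e) (P := P)) => [|x _]; last exact: tE.
by congr hf_bool; apply: eq_forallb => f; rewrite inE.
Qed.

(** The bounds on [x] and [y] prevent their capture by the bound variables 20 and 21, which hold the
    segments of the two feet. *)
Lemma eval_le b x y e (f g : foot (side b)) : x < 20 -> y < 20 ->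
  e x = foot_obj f -> e y = foot_obj g ->
  eval A (t_le b x y) e = hf_bool (sle (seg_of f) (seg_of g)).
Proof.
move=> x20 y20 ex ey.
rewrite (eval_ex_in (eval_segs b e) (P := fun s => [exists t in setT,
  [&& seg_of f == s, seg_of g == t & sle s t]])) => [|s _].
  congr hf_bool; apply/existsP/idP => [[s] | le].
    by case/andP=> _ /existsP[t] /andP[_] /and3P[/eqP<- /eqP<-].
  exists (seg_of f); rewrite inE; apply/existsP; exists (seg_of g).
  by rewrite inE !eqxx.
apply: (eval_ex_in (eval_segs b _)) => t _.
have [xE yE] : (x == 20) = false /\ (x == 21) = false by lia.
have [zE wE] : (y == 20) = false /\ (y == 21) = false by lia.
do 2?apply: eval_and.
- apply: (@eval_rel b RSegOf _ [:: inl (inr f); inl (inl s)]).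
  by rewrite /= /assign xE yE ex.
- apply: (@eval_rel b RSegOf _ [:: inl (inr g); inl (inl t)]).
  by rewrite /= /assign zE wE ey.
- exact: (@eval_rel b RLe _ [:: inl (inl s); inl (inl t)]).
Qed.

Lemma eval_matched x y e (S : {set pair_type}) f g :
  e 0 = match_obj S -> e x = @foot_obj false f -> e y = @foot_obj true g ->
  eval A (t_matched x y) e = hf_bool ((f, g) \in S).
Proof.
move=> /= -> -> ->.
by rewrite -[hfset _]/(pair_obj (f, g)) (mem_encode _ _ pair_obj_inj).
Qed.

Lemma eval_extendable e (S : {set pair_type}) f g :
  e 0 = match_obj S -> e 1 = @foot_obj false f -> e 2 = @foot_obj true g ->
  eval A t_extendable e = hf_bool (extendable S (f, g)).
Proof.
move=> e0 e1 e2; apply: eval_and.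
  apply: eval_all_foot => f'; apply: eval_imp.
    by apply: eval_not; apply: eval_le.
  apply: eval_ex_foot => g'; apply: eval_and; last exact: eval_matched.
  by apply: eval_not; apply: eval_le.
apply: eval_all_foot => g'; apply: eval_imp.
  by apply: eval_not; apply: eval_le.
apply: eval_ex_foot => f'; apply: eval_and; last exact: eval_matched.
by apply: eval_not; apply: eval_le.
Qed.

Lemma eval_good e (S : {set pair_type}) :
  e 0 = match_obj S -> eval A t_good e = hf_bool (good S).
Proof.
move=> e0; apply: eval_and; last apply: eval_and.
- apply: eval_all_foot => f; apply: eval_ex_foot => g; exact: eval_matched.
- apply: eval_all_foot => f; apply: eval_ex_foot => g; exact: eval_matched.
apply: eval_all_foot => f; apply: eval_all_foot => g; apply: eval_imp.
  exact: eval_matched.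
apply: eval_and; first apply: eval_iff.
- exact: (@eval_rel false RShoe _ [:: inl (inr f)]).
- exact: (@eval_rel true RShoe _ [:: inl (inr g)]).
apply: eval_all_foot => f'; apply: eval_all_foot => g'; apply: eval_imp.
  exact: eval_matched.
apply: eval_and; first apply: eval_iff.
- by rewrite /= -(inj_eq (@foot_obj_inj false)).
- by rewrite /= -(inj_eq (@foot_obj_inj true)).
apply: eval_and; first by apply: eval_iff; apply: eval_le.
apply: eval_all_foot => f''; apply: eval_all_foot => g''; apply: eval_imp.
  exact: eval_matched.
apply: eval_iff.
- exact: (@eval_rel false RPositive _ [:: inl (inr f); inl (inr f'); inl (inr f'')]).
- exact: (@eval_rel true RPositive _ [:: inl (inr g); inl (inr g'); inl (inr g'')]).
Qed.

Definition family_obj : {set {set pair_type}} -> obj := encode match_obj.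

Lemma family_obj_inj : injective family_obj.
Proof. exact/encode_inj/match_obj_inj. Qed.

(** One round of the program is one application of [extend]; both values are compared element by
    element. *)
Lemma eval_extend e (F : {set {set pair_type}}) :
  A Family [::] = family_obj F -> eval A t_extend e = family_obj (extend F).
Proof.
move=> AF; apply: encode_ext => [|y]; first exact: get_atom_hfset.
have FE e' : eval A (fix_dyn _ Family) e' = encode match_obj F by [].
have addE (e' : valuation I) S f g : e' 0 = match_obj S ->
    e' 1 = @foot_obj false f -> e' 2 = @foot_obj true g ->
    eval A (t_cup (t_sing (TPair (var 1) (var 2))) (var 0)) e' =
    match_obj ((f, g) |: S).
  move=> e0 e1 e2; apply: encode_ext => [|z]; first exact: get_atom_hfset.
  rewrite mem_cup mem_sing /= e0 e1 e2.
  apply: (iffP orP) => [[/eqP->|/encodeP[p pS ->]]|[p]].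
  - by exists (f, g); rewrite ?setU11.
  - by exists p; rewrite ?setU1r.
  rewrite in_setU1 => /orP[/eqP-> ->|pS ->]; first by left.
  by right; apply/encodeP; exists p.
rewrite mem_cup mem_sing; apply: (iffP orP).
  case=> [/eqP->|/(mem_bigcup _ _ _ (FE _))[S SF]].
    exists set0; first by rewrite inE eqxx.
    by rewrite /match_obj encode0.
  case/(mem_bigcup _ _ _ (eval_feet _ _))=> f _.
  case/(mem_compr (P := fun g : foot (side true) => extendable S (f, g)) _ _ (eval_feet _ _)).
    by move=> g _; apply: eval_extendable.
  move=> g; rewrite inE /= => ext ->; exists ((f, g) |: S); last exact: addE.
  rewrite inE; apply/orP; right; apply/existsP; exists S; rewrite SF.
  by apply/existsP; exists (f, g); rewrite ext eqxx.
case=> B; rewrite inE => /orP[/eqP-> ->|].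
  by left; rewrite /match_obj encode0.
case/existsP=> S /andP[SF /existsP[[f g] /andP[ext /eqP->]]] ->; right.
apply/(mem_bigcup _ _ _ (FE _)); exists S => //.
apply/(mem_bigcup _ _ _ (eval_feet _ _)); exists f; rewrite ?inE //.
apply/(mem_compr (P := fun g : foot (side true) => extendable S (f, g)) _ _ (eval_feet _ _)).
  by move=> g' _; apply: eval_extendable.
by exists g; [rewrite inE|exact/esym/addE].
Qed.

Lemma eval_answer e (F : {set {set pair_type}}) :
  A Family [::] = family_obj F ->
  eval A t_answer e = hf_bool [exists S in F, good S].
Proof.
move=> AF; apply: (eval_ex_in (c := match_obj)) => // S _.
exact: eval_good.
Qed.

End Eval.
End PairTerms.

(** * Resource bounds and the complete run *)

Section PairRun.
Variable MN : shod_multipede4 * shod_multipede4.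
Local Notation I := (pair_structure MN).
Local Notation n := #|dom I|.
Local Notation pair_type := (foot MN.1 * foot MN.2)%type.

(** The elements of sort sets alone give [2 ^ #|seg MN.1| <= n], and at most [4 * #|seg MN.1|] pairs
    have equal ranks. *)
Lemma card_powerset_same_rank : #|powerset (same_rank MN.1 MN.2)| <= n ^ 4.
Proof.
have le_n : 2 ^ #|seg MN.1| <= n.
  apply: leq_trans (card_sets _) _.
  by rewrite !card_sum; lia.
rewrite card_powerset.
apply: leq_trans (leq_pexp2l _ (card_same_rank MN.1 MN.2)) _ => //.
by rewrite mulnC expnM leq_exp2r.
Qed.

Lemma card_pairs : #|{: pair_type}| <= n ^ 2.
Proof.
by rewrite card_prod expnS expn1 !card_sum; apply: leq_mul; lia.
Qed.

(** The elements of families are matchings, those of matchings are pairs, and those of pairs are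
    atoms. All subsets of [same_rank] are listed, which covers the matchings of every stage. *)
Definition active_objects k : seq (hf (dom I)) :=
  [seq family_obj (iter j (@extend MN.1 MN.2) set0) | j <- iota 0 k.+1] ++
  [seq match_obj B | B <- enum (powerset (same_rank MN.1 MN.2))] ++
  [seq pair_obj p | p : pair_type] ++
  [seq atom a | a : dom I] ++ [:: hf0; hf_bool true].

Lemma size_active_objects k :
  size (active_objects k) =
  k.+1 + #|powerset (same_rank MN.1 MN.2)| + #|{: pair_type}| + n + 2.
Proof.
by rewrite !size_cat !size_map size_iota -!cardE -!enumT -!cardE !addnA.
Qed.

Lemma mem_active_objects k x : (x \in active_objects k) =
  [|| x \in [seq family_obj (iter j (@extend MN.1 MN.2) set0) | j <- iota 0 k.+1],
      x \in [seq match_obj B | B <- enum (powerset (same_rank MN.1 MN.2))],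
      x \in [seq pair_obj p | p : pair_type], x \in [seq atom a | a : dom I]
    | x \in [:: hf0; hf_bool true]].
Proof. by rewrite !mem_cat. Qed.

Lemma closed_active_objects k x y :
  x \in active_objects k -> y \in elems x -> y \in active_objects k.
Proof.
rewrite !mem_active_objects.
case/or4P => [/mapP[j _ ->]|/mapP[B _ ->]|/imageP[p _ ->]|/orP[/imageP[a _ ->]|]].
- case/encodeP=> B Bj ->; apply/or4P/Or42/map_f; rewrite mem_enum.
  exact: (subsetP (iter_extend_same_rank _ _ j)).
- by case/encodeP=> p _ ->; apply/or4P/Or43/image_f.
- rewrite mem_hfset !inE => /orP[] /eqP ->; apply/or4P/Or44/orP; left;
    exact: (image_f (@atom (dom I))).
- by [].
rewrite !inE => /orP[] /eqP ->; first by rewrite mem_hfset.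
by rewrite mem_hfset inE => /eqP ->; rewrite eqxx !orbT.
Qed.

(** The step bound allows [n ^ 4] rounds and two steps to record the answer and halt. The active
    bound adds [n ^ 4 + 1] families, [n ^ 4] matchings, [n ^ 2] pairs, [n] atoms and two truth
    values. *)
Lemma isomorphism_program_answers :
  exists2 b : bool, b <-> isomorphic MN.1 MN.2 &
    answers (PTimeProgram isomorphism_program
      ('X^4 + 2%:P)%R ('X^4 + 'X^4 + 'X^2 + 'X + 3%:P)%R) I b.
Proof.
have [k [le_k lt_k st_k]] :=
  iter_stabilizes (@extend_mono MN.1 MN.2) (@iter_extend_same_rank MN.1 MN.2).
set F := iter k (@extend _ _) set0 in st_k.
have le_kn := leq_trans le_k card_powerset_same_rank.
(* The verdict is a search in the stable family, so isomorphism is decided without excluded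
   middle. *)
exists [exists S in F, good S].
  split=> [/existsP[S /andP[_]]|iso]; first exact: good_isomorphic.
  by apply: isomorphic_good iso _; rewrite (st_k : extend F = F).
have mem_family j : j <= k ->
    family_obj (iter j (@extend MN.1 MN.2) set0) \in active_objects k.
  move=> le_jk; rewrite mem_active_objects; apply/or4P/Or41.
  by apply: (map_f (fun j => family_obj (iter j _ set0))); rewrite mem_iota.
apply: (@fix_program_answers pair_vocabulary t_extend t_answer isT isT isT I
  (fun j => family_obj (iter j (@extend MN.1 MN.2) set0)) k _
  _ _ _ _ _ _ _ (active_objects k)) => //.
- exact: encode0.
- by move=> j lt_jk /family_obj_inj; exact: lt_k.
- by rewrite st_k.
- by move=> A j e; exact: eval_extend.
- by move=> A e; exact: eval_answer.
- by rewrite hornerD hornerXn hornerC natrDE natrXE leq_add2r.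
- rewrite size_active_objects.
  rewrite !hornerD !hornerXn hornerX hornerC !natrDE !natrXE.
  have := card_pairs; have := card_powerset_same_rank; lia.
- exact: closed_active_objects.
- by move=> a; rewrite mem_active_objects map_f ?orbT // mem_enum.
- by rewrite mem_active_objects !inE eqxx !orbT.
Qed.

End PairRun.

Theorem mainTheorem5 :
  in_CPTime pair_structure (fun MN => isomorphic MN.1 MN.2).
Proof.
exists (PTimeProgram isomorphism_program
  ('X^4 + 2%:P)%R ('X^4 + 'X^4 + 'X^2 + 'X + 3%:P)%R) => MN.
have [[] bP ans] := isomorphism_program_answers MN; split=> //.
- by move=> niso; case: niso; apply/bP.
- by move/bP.
Qed.
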